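(* Let $C \subseteq \mathbb{R}^2$ be a polytopal cone, and put $R_C := \{p \in C : -p \notin C\}$ and $G_C := \{p \in \partial C : -p \in \partial C\}$. Then $C$ is the positivity set of a hinge function $h:\mathbb{R}^2\to\mathbb{R}$ if and only if $$\langle G_C \rangle \cap \operatorname{Conv}(R_C) = \emptyset,$$ where $\langle G_C\rangle$ is the linear span of $G_C$ and $\operatorname{Conv}(R_C)$ is the convex hull of $R_C$.
   Context: A hinge function on $\mathbb{R}^d$ is a function $h:\mathbb{R}^d\to\mathbb{R}$ of the form $h(\boldsymbol{x}) = L_0(\boldsymbol{x}) + \sum_{i=1}^s |L_i(\boldsymbol{x})| - \sum_{j=s+1}^t |L_j(\boldsymbol{x})|$ for some integers $0\le s\le t$, where $L_0,L_1,\dots,L_t:\mathbb{R}^d\to\mathbb{R}$ are affine linear functions (possibly constant). The positivity set of $h$ is $\{\boldsymbol{x}\in\mathbb{R}^d : h(\boldsymbol{x})>0\}$. A polytopal set in $\mathbb{R}^d$ is a finite union of open, possibly unbounded, polytopes (an open polytope being an intersection of finitely many open half-spaces; the whole space, as the empty intersection, and the empty set are allowed). In particular a polytopal set is open. A polytopal cone is a polytopal set $C$ such that $p\in C$ implies $\lambda p\in C$ for every real $\lambda>0$. $\partial C$ denotes the topological boundary of $C$. The linear span of the empty set is $\{\boldsymbol{0}\}$, and the convex hull of the empty set is empty. *)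

(* Defs.v *)
From HB Require Import structures.
From mathcomp Require Import all_boot all_order all_algebra.
From mathcomp Require Import all_classical all_reals all_analysis.
Set Implicit Arguments.
Unset Strict Implicit.
Unset Printing Implicit Defensive.
Import Order.TTheory GRing.Theory Num.Theory.
Import numFieldNormedType.Exports.
Local Open Scope classical_set_scope.
Local Open Scope ring_scope.

Definition boundary (T : topologicalType) (A : set T) : set T :=
  closure A `\` interior A.

Definition linear_span (R : realType) (E : lmodType R) (A : set E) : set E :=
  smallest [set V : set E | submod_closed (mem V)] A.

Definition convex_hull (R : realType) (E : lmodType R) (A : set E) : set E :=
  smallest (@convex_set R E) A.

Lemma linear_span0 (R : realType) (E : lmodType R) :
  linear_span (@set0 E) = [set 0].
Proof.
apply/seteqP; split=> x.
  apply: smallest_sub => //; split; first by apply/mem_set.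
  by move=> a u v /set_mem -> /set_mem ->; apply/mem_set; rewrite scaler0 addr0.
by move=> -> V [[/set_mem V0 _] _].
Qed.

Lemma convex_hull0 (R : realType) (E : lmodType R) :
  convex_hull (@set0 E) = set0.
Proof. by apply: smallest_id => x y l; rewrite inE. Qed.

Section hinge.
Variables (R : realType) (d : nat).
Implicit Types (A : set 'rV[R]_d) (f h : 'rV[R]_d -> R).

Definition affine_linear f : Prop :=
  exists (l : {scalar 'rV[R]_d}) (b : R), forall x, f x = l x + b.

Definition hinge_function h : Prop :=
  exists (s t : nat) (L : nat -> 'rV[R]_d -> R),
    [/\ (s <= t)%N,
        forall i, (i <= t)%N -> affine_linear (L i) &
        forall x, h x = L 0%N x + \sum_(1 <= i < s.+1) `|L i x|
                                - \sum_(s.+1 <= j < t.+1) `|L j x|].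

Definition positivity_set f : set 'rV[R]_d := [set x | 0 < f x].

Definition open_halfspace A : Prop :=
  exists (l : {scalar 'rV[R]_d}) (b : R),
    (exists x, l x != 0) /\ A = [set x | 0 < l x + b].

(* The intersection over the empty family is the whole space. *)
Definition open_polytope A : Prop :=
  exists F : set (set 'rV[R]_d),
    [/\ finite_set F, F `<=` open_halfspace & A = \bigcap_(H in F) H].

Definition polytopal_set A : Prop :=
  exists F : set (set 'rV[R]_d),
    [/\ finite_set F, F `<=` open_polytope & A = \bigcup_(P in F) P].

Definition polytopal_cone A : Prop :=
  polytopal_set A /\
  forall (p : 'rV[R]_d) (lambda : R), A p -> 0 < lambda -> A (lambda *: p).

Definition cone_R A : set 'rV[R]_d := [set p | A p /\ ~ A (- p)].

Definition cone_G A : set 'rV[R]_d :=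
  [set p | boundary A p /\ boundary A (- p)].

End hinge.

(* Main.v *)
From HB Require Import structures.
Require Import Defs.
From mathcomp Require Import all_boot all_order all_algebra.
From mathcomp Require Import all_classical all_reals all_analysis.
From mathcomp Require Import ring lra.
Set Implicit Arguments.
Unset Strict Implicit.
Unset Printing Implicit Defensive.
Import Order.TTheory GRing.Theory Num.Theory.
Import numFieldNormedType.Exports.
Local Open Scope classical_set_scope.
Local Open Scope ring_scope.

(* Necessity: near the origin the odd part of a hinge function is a linear form
   [g]; comparing [h] at [p] and [-p] gives [g = 0] on [cone_G C] and [g > 0] on
   [cone_R C].

   Sufficiency: if [cone_R C] is empty the construction below works with [l]
   dropped from the final formula and both thresholds equal to 0. Otherwise there is a linear
   form [l] vanishing on [cone_G C] and positive on [cone_R C]; when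
   [cone_G C `<=` [set 0]] its existence uses that, for [p] in [cone_R C], [-p] is
   not adherent to [cone_R C].
   On the affine line [l = 1] with coordinate [t], one needs a profile
   [phi t = c + \sum a_i |t - t_i|] with [phi > -1] exactly on [C] and [phi > 1]
   exactly on [-C]; it is obtained by piecewise affine interpolation of the values
   -1, 1, 2, the point being that a value 2 is never adjacent to a value -1,
   since such a point would lie in [cone_G C]. The sum of the [a_i] decides the sign
   on the line [l = 0]. The homogenization
   [l + c |l| + \sum a_i |u - t_i l|] of [phi] is the required hinge function. *)

(** * Piecewise affine interpolation on the real line *)

Section OneDimensional.
Variable R : realType.
Implicit Types (c t x y M : R) (s : seq (R * R)) (phi v : R -> R).

Definition abs_comb c s t : R := c + \sum_(p <- s) p.1 * `|t - p.2|.

Definition slope s : R := \sum_(p <- s) p.1.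

Lemma abs_combD c1 s1 c2 s2 t :
  abs_comb c1 s1 t + abs_comb c2 s2 t = abs_comb (c1 + c2) (s1 ++ s2) t.
Proof. by rewrite /abs_comb big_cat /= addrACA. Qed.

Lemma slopeD s1 s2 : slope (s1 ++ s2) = slope s1 + slope s2.
Proof. by rewrite /slope big_cat. Qed.

(** Two kinks with opposite weights cancel outside [[p, q]], which leaves a ramp. *)
Lemma abs_comb_step p q y : p < q ->
  exists c s, [/\ slope s = 0, forall t, t <= p -> abs_comb c s t = 0,
    forall t, q <= t -> abs_comb c s t = y &
    forall t, p <= t -> t <= q -> abs_comb c s t = (t - p) / (q - p) * y].
Proof.
move=> pq; pose k := y / (2 * (q - p)).
exists (y / 2), [:: (k, p); (- k, q)]; rewrite /slope /abs_comb.
split=> [|t tp|t qt|t pt tq]; rewrite !big_cons big_nil /= addr0 ?subrr //.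
- rewrite [`|t - p|]ler0_norm ?[`|t - q|]ler0_norm ?subr_le0 //; last lra.
  by rewrite /k; field; lra.
- rewrite [`|t - p|]ger0_norm ?[`|t - q|]ger0_norm ?subr_ge0 //; last lra.
  by rewrite /k; field; lra.
- rewrite [`|t - p|]ger0_norm ?[`|t - q|]ler0_norm ?subr_ge0 ?subr_le0 //.
  by rewrite /k; field; lra.
Qed.

(** Serves to raise the slope of a profile without disturbing it on a bounded range or lowering it
    elsewhere. *)
Lemma abs_comb_tail M : 0 < M ->
  exists c s, [/\ slope s = 1, forall t, `|t| <= M -> abs_comb c s t = 0 &
    forall t, 0 <= abs_comb c s t].
Proof.
move=> M0; exists (- M), [:: (1 / 2, M); (1 / 2, - M)].
rewrite /slope /abs_comb.
split=> [|t|t]; rewrite !big_cons big_nil /= ?addr0; first by lra.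
  rewrite ler_norml => /andP[h1 h2].
  by rewrite ler0_norm ?ger0_norm; lra.
have := ler_norm (t - M); have := ler_norm (- (t - M)); rewrite normrN.
have := ler_norm (t - - M); have := ler_norm (- (t - - M)); rewrite normrN.
lra.
Qed.

(** Constancy on each component of the complement of [S]; the values at the points of [S] are
    free. *)
Definition constant_off (T : Type) (S : seq R) (v : R -> T) : Prop :=
  forall x y, x < y -> (forall z, z \in S -> ~ (x <= z /\ z <= y)) -> v x = v y.

Definition adherent (P : R -> Prop) (x : R) : Prop :=
  forall e : R, 0 < e -> exists2 t, `|t - x| < e & P t.

(** The value mixed with [v t] comes from a point [tau] adherent to the level set of [v] through
    [t], so topological information on level sets bounds [phi t]; [0 < lam] makes the bounds
    strict. *)
Definition interpolates phi v : Prop :=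
  forall t, exists (tau lam : R), [/\ 0 < lam <= 1,
    phi t = lam * v t + (1 - lam) * v tau & adherent (fun u => v u = v t) tau].

Lemma adherent_id (P : R -> Prop) x : P x -> adherent P x.
Proof. by move=> Px e e0; exists x; rewrite ?subrr ?normr0. Qed.

Lemma separate_above (s : seq R) x : (forall z, z \in s -> z < x) ->
  exists2 m, m < x & forall z, z \in s -> z < m.
Proof.
elim: s => [|a s IH] H; first by exists (x - 1) => //; lra.
have [|m mx Hm] := IH; first by move=> z zs; apply: H; rewrite inE zs orbT.
have ax : a < x by apply: H; rewrite mem_head.
exists ((Num.max a m + x) / 2); first by have [] := leP a m; lra.
move=> z; rewrite inE => /orP[/eqP ->|/Hm]; have [] := leP a m; lra.
Qed.

(** Induction on the largest breakpoint [z]: [v] is frozen before [z], and two ramps, from [m] to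
    [z] and from [z] to [M], restore the values [v z] and [v M]. The last conclusion provides the
    constant level to which the next ramps are added. *)
Lemma interpolation_sorted (S : seq R) : sorted <%R S ->
  forall v M, constant_off S v -> (forall z, z \in S -> z < M) ->
  exists c s, [/\ slope s = 0, interpolates (abs_comb c s) v &
    forall t, M <= t -> abs_comb c s t = v M].
Proof.
have stay v t y : y = v t -> exists (tau lam : R),
    [/\ 0 < lam <= 1, y = lam * v t + (1 - lam) * v tau &
      adherent (fun u => v u = v t) tau].
  move=> e; exists t, 1; split; [by lra|by rewrite e; ring|exact: adherent_id].
elim/last_ind: S => [|S z IH] sortS v M vS ltM.
  have vc x y : v x = v y.
    by have [xy|yx|->//] := ltgtP x y; [|symmetry]; apply: vS.
  have e t : abs_comb (v 0) [::] t = v 0 by rewrite /abs_comb big_nil addr0.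
  exists (v 0), [::]; split=> [|t|t _]; first by rewrite /slope big_nil.
    by apply: stay; rewrite e.
  by rewrite e.
have ltz x : x \in S -> x < z.
  move: sortS; rewrite -cats1 lt_sorted_pairwise pairwise_cat allrel1r.
  by case/andP=> /allP + _ => /[apply].
have [m mz ltm] := separate_above ltz.
have zM : z < M by apply: ltM; rewrite mem_rcons mem_head.
have vlow x y : x < y -> y < z -> (forall w, w \in S -> ~ (x <= w /\ w <= y)) ->
    v x = v y.
  move=> xy yz H; apply: vS => // w; rewrite mem_rcons inE => /orP[/eqP ->|/H//].
  by lra.
have vmid t : m <= t -> t < z -> v t = v m.
  rewrite le_eqVlt => /orP[/eqP ->//|mt] tz; symmetry; apply: vlow => // w wS.
  by have := ltm _ wS; lra.
have vhigh t : z < t -> v t = v M.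
  have H x y : z < x -> x < y -> v x = v y.
    move=> zx xy; apply: vS => // w.
    rewrite mem_rcons inE => /orP[/eqP ->|/ltz]; lra.
  by move=> zt; have [tM|Mt|->//] := ltgtP t M; [|symmetry]; apply: H.
pose v' t := if t < z then v t else v m.
have v'mid t : m <= t -> v' t = v m.
  by move=> mt; rewrite /v'; case: ltP => // tz; apply: vmid.
have v'S : constant_off S v'.
  move=> x y xy H; have [yz|zy] := ltP y z.
    by rewrite /v' yz (lt_trans xy yz); apply: vlow.
  rewrite [v' y]v'mid; last lra.
  have [mx|xm] := leP m x; first exact: v'mid.
  rewrite /v' (_ : x < z); last lra.
  apply: vlow => // w wS; have := H _ wS; have := ltm _ wS; lra.
have sS : sorted <%R S.
  by move: sortS; rewrite -cats1 => /cat_sorted2[].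
have [c0 [s0 [sl0 in0 e0]]] := IH sS v' m v'S ltm.
have v'm : v' m = v m by apply: v'mid.
have [c1 [s1 [sl1 l1 h1 m1]]] := abs_comb_step (v z - v m) mz.
have [c2 [s2 [sl2 l2 h2 m2]]] := abs_comb_step (v M - v z) zM.
exists (c0 + c1 + c2), ((s0 ++ s1) ++ s2); split.
- by rewrite !slopeD sl0 sl1 sl2 !addr0.
- move=> t; rewrite -!abs_combD.
  have [tm|mt] := leP t m.
    rewrite l1 // l2 ?addr0; last lra.
    have v't : v' t = v t by rewrite /v' (_ : t < z) //; lra.
    have [tau [lam [lam01 -> adh]]] := in0 t; rewrite v't in adh *.
    have [tz|zt] := ltP tau z.
      exists tau, lam; split=> //; first by rewrite /v' tz.
      move=> e ep; have [|u] := adh (Num.min e (z - tau)).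
        by rewrite lt_min ep subr_gt0.
      rewrite lt_min => /andP[ue uz]; rewrite /v' (_ : u < z).
        by exists u.
      by have := ler_norm (u - tau); lra.
    apply: stay; have [|u] := adh (tau - m); first lra.
    move=> ut; have := ler_norm (- (u - tau)); rewrite normrN => mu.
    by rewrite (v'mid u) ?(v'mid tau) => [<-| |]; [ring|lra|lra].
  have [tz|zt] := ltP t z.
    rewrite e0 ?m1 ?l2 ?v'm; try lra.
    rewrite (vmid t) //; try lra.
    exists z, ((z - t) / (z - m)); split.
    + by rewrite divr_gt0 ?subr_gt0 //= ler_pdivrMr ?subr_gt0 //; lra.
    + by field; lra.
    + move=> e ep; pose d := Num.min e (z - m) / 2.
      have [d0 de dz] : [/\ 0 < d, d < e & d <= z - m].
        by rewrite /d; have [] := leP e (z - m); split; lra.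
      exists (z - d); first by rewrite distrC ger0_norm; lra.
      by rewrite vmid //; lra.
  have [tM|Mt] := ltP t M; last first.
    rewrite e0 ?h1 ?h2 ?v'm; try lra.
    by apply: stay; rewrite (vhigh t); lra.
  rewrite e0 ?h1 ?m2 ?v'm; try lra.
  case: (eqVneq t z) => [->|tz].
    by apply: stay; rewrite subrr mul0r mul0r; lra.
  have {tz} zt' : z < t by rewrite lt_neqAle eq_sym tz.
  rewrite (vhigh t) //.
  exists z, ((t - z) / (M - z)); split.
  + by rewrite divr_gt0 ?subr_gt0 //= ler_pdivrMr ?subr_gt0 //; lra.
  + by field; lra.
  + move=> e ep; pose d := Num.min e (M - z) / 2.
    have [d0 de dz] : [/\ 0 < d, d < e & d <= M - z].
      by rewrite /d; have [] := leP e (M - z); split; lra.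
    exists (z + d); first by rewrite ger0_norm; lra.
    by rewrite vhigh //; lra.
- move=> t Mt; rewrite -!abs_combD e0 ?h1 ?h2 ?v'm; lra.
Qed.

Lemma interpolation (S : seq R) v : constant_off S v ->
  exists c s, slope s = 0 /\ interpolates (abs_comb c s) v.
Proof.
move=> vS; pose T := sort <=%R (undup S).
have memT z : (z \in T) = (z \in S) by rewrite mem_sort mem_undup.
have [M HM] : exists M, forall z, z \in T -> z < M.
  elim: (T) => [|a T' [M HM]]; first by exists 0.
  exists (Num.max M (a + 1)) => z; rewrite inE lt_max => /orP[/eqP ->|/HM ->//].
  by rewrite ltrDl ltr01 orbT.
have [|x y xy H||c [s [sl int _]]] := @interpolation_sorted T _ v M => //.
- by rewrite /T sort_lt_sorted undup_uniq.
- by apply: vS => // z; rewrite -memT; apply: H.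
- by exists c, s.
Qed.

End OneDimensional.

(** * Hinge functions: normal form, odd part, continuity; half-spaces, hulls and spans *)

Section Hinges.
Variables (R : realType) (d : nat).
Local Notation V := 'rV[R]_d.
Implicit Types (x : V) (f g h : V -> R).

Lemma scalar_ex g : scalar g -> exists l : {scalar V}, l =1 g.
Proof.
move=> gP; pose L := GRing.isLinear.Build R V R *%R g gP.
by exists (HB.pack_for {scalar V} g L).
Qed.

Lemma affineZ (k : R) f : affine_linear f -> affine_linear (fun x => k * f x).
Proof.
move=> [l [b fE]]; have [|m mE] := @scalar_ex (fun x => k * l x).
  by move=> c x y; rewrite !linearP /=; ring.
by exists m, (k * b) => x; rewrite fE mE mulrDr.
Qed.

Lemma hinge_seq f (P N : seq (V -> R)) : affine_linear f ->
  {in P ++ N, forall g, affine_linear g} ->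
  hinge_function (fun x => f x + \sum_(g <- P) `|g x| - \sum_(g <- N) `|g x|).
Proof.
(* Index 0 carries [f]; [P] fills the indices 1 to [size P], and [N] the following ones. *)
move=> fA PN; exists (size P), (size P + size N)%N, (nth f (f :: P ++ N)).
split=> [|[|i] /= iPN|x]; first exact: leq_addr.
- by [].
- by apply/PN/mem_nth; rewrite size_cat.
- congr (_ + _ - _).
    rewrite big_add1 /= (big_nth f) !big_mkord; apply: eq_bigr => i _.
    by rewrite nth_cat ltn_ord.
  rewrite (big_nth f) big_mkord big_add1 /= -{1}[size P]add0n big_addn addKn.
  rewrite big_mkord; apply: eq_bigr => i _.
  by rewrite nth_cat ltnNge leq_addl /= addnK.
Qed.

(** A weight [k] is absorbed as [|k g|] or [- |k g|] according to its sign. *)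
Lemma hinge_comb f (s : seq (R * (V -> R))) : affine_linear f ->
  {in s, forall p, affine_linear p.2} ->
  hinge_function (fun x => f x + \sum_(p <- s) p.1 * `|p.2 x|).
Proof.
move=> fA sA; suff [P [N [PN E]]] : exists P N : seq (V -> R),
    {in P ++ N, forall g, affine_linear g} /\ forall x,
    \sum_(p <- s) p.1 * `|p.2 x| = \sum_(g <- P) `|g x| - \sum_(g <- N) `|g x|.
  rewrite (_ : (fun x => _) =
    fun x => f x + \sum_(g <- P) `|g x| - \sum_(g <- N) `|g x|).
    exact: hinge_seq.
  by apply/funext => x; rewrite E addrA.
elim: s sA => [|[k g] s IH] sA.
  by exists [::], [::]; split=> // x; rewrite !big_nil subr0.
have [|P [N [PN E]]] := IH; first by move=> p ps; apply: sA; rewrite inE ps orbT.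
have gA : affine_linear g by apply: (sA (k, g)); rewrite mem_head.
have [k0|k0] := leP 0 k.
  exists ((fun x => k * g x) :: P), N; split=> [g'|x].
    by rewrite inE => /orP[/eqP ->|/PN//]; exact: affineZ.
  by rewrite !big_cons /= E normrM ger0_norm // addrA.
exists P, ((fun x => k * g x) :: N); split=> [g'|x].
  rewrite mem_cat inE orbCA -mem_cat => /orP[/eqP ->|/PN//]; exact: affineZ.
by rewrite !big_cons /= E normrM ltr0_norm //; ring.
Qed.

(** The threshold [e0] may depend on [x]; only the resulting form [g] must be globally linear. *)
Definition odd_germ f : Prop := exists2 g, scalar g & forall x,
  exists2 e0 : R, 0 < e0 & forall e : R, 0 < e -> e < e0 ->
    f (e *: x) - f (- (e *: x)) = e * g x.

Lemma odd_germ0 : odd_germ (fun=> 0).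
Proof.
exists (fun=> 0) => [k x y|x]; first by rewrite mulr0 addr0.
by exists 1 => // e _ _; rewrite subrr mulr0.
Qed.

Lemma odd_germDZ f (k : R) g : odd_germ f -> odd_germ g ->
  odd_germ (fun x => f x + k * g x).
Proof.
move=> [f' f'S fE] [g' g'S gE]; exists (fun x => f' x + k * g' x).
  by move=> c x y; rewrite f'S g'S; ring.
move=> x; have [e0 e0p {}fE] := fE x; have [e1 e1p {}gE] := gE x.
exists (Num.min e0 e1); first by rewrite lt_min e0p.
move=> e ep; rewrite lt_min => /andP[/(fE _ ep) h1 /(gE _ ep) h2].
by rewrite mulrDr -h1 mulrCA -h2; ring.
Qed.

Lemma odd_germ_sum (r : seq nat) (F : nat -> V -> R) :
  (forall i, i \in r -> odd_germ (F i)) ->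
  odd_germ (fun x => \sum_(i <- r) F i x).
Proof.
elim: r => [|i r IH] rF.
  by rewrite (_ : (fun x => _) = fun=> 0) ?funeqE => [|x];
    [exact: odd_germ0|rewrite big_nil].
rewrite (_ : (fun x => _) = fun x => F i x + 1 * \sum_(j <- r) F j x).
  apply: odd_germDZ; first by apply: rF; rewrite mem_head.
  by apply: IH => j jr; apply: rF; rewrite inE jr orbT.
by apply/funext => x; rewrite big_cons mul1r.
Qed.

Lemma odd_germ_affine f : affine_linear f -> odd_germ f.
Proof.
move=> [l [b fE]]; exists (fun x => 2 * l x) => [k x y|x].
  by rewrite linearP /=; ring.
by exists 1 => // e _ _; rewrite !fE linearN linearZ /=; ring.
Qed.

(* Near the origin [l + b] keeps the sign of [b], and [`|l|] is even. *)
Lemma odd_germ_norm_affine f : affine_linear f -> odd_germ (fun x => `|f x|).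
Proof.
move=> [l [b fE]]; exists (fun x => 2 * Num.sg b * l x) => [k x y|x].
  by rewrite linearP /=; ring.
have [b0|b0] := eqVneq b 0.
  exists 1 => // e _ _; rewrite !fE b0 sgr0 !addr0 linearN normrN; ring.
have c0 : 0 < `|l x| + 1 by rewrite ltr_wpDl.
(* Guarantees [|e * l x| < |b|]; adding 1 covers [l x = 0]. *)
exists (`|b| / (`|l x| + 1)); first by rewrite divr_gt0 ?normr_gt0.
move=> e e0; rewrite ltr_pdivlMr // => eb.
rewrite !fE linearN linearZ /=.
have le : `|e * l x| < `|b| by rewrite normrM gtr0_norm //; lra.
have [bp|bn|/eqP] := ltgtP b 0; last by rewrite (negPf b0).
  move: le; rewrite (ltr0_norm bp) ltr_norml => /andP[h1 h2].
  by rewrite !ltr0_norm ?ltr0_sg //; [ring|lra|lra].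
move: le; rewrite (gtr0_norm bn) ltr_norml => /andP[h1 h2].
by rewrite !gtr0_norm ?gtr0_sg //; [ring|lra|lra].
Qed.

Lemma hinge_odd_germ h : hinge_function h -> odd_germ h.
Proof.
move=> [s [t [L [st LA hE]]]].
rewrite (_ : h = fun x => (L 0%N x + 1 * \sum_(1 <= i < s.+1) `|L i x|) +
                       (- 1) * \sum_(s.+1 <= j < t.+1) `|L j x|); last first.
  by apply/funext => x; rewrite hE mul1r mulN1r.
apply: odd_germDZ; [apply: odd_germDZ|]; first by apply/odd_germ_affine/LA.
  apply: odd_germ_sum => i; rewrite mem_index_iota => /andP[_ /= iS].
  by apply/odd_germ_norm_affine/LA/(leq_trans _ st).
apply: odd_germ_sum => i; rewrite mem_index_iota => /andP[_ /= iS].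
exact/odd_germ_norm_affine/LA.
Qed.

Lemma continuous_scalar (l : {scalar V}) : continuous l.
Proof.
rewrite (_ : l = (fun x => \sum_(i < d) x 0 i * l (delta_mx 0 i)) :> (V -> R)).
  apply: continuous_big => [|i _ x]; first exact: add_continuous.
  apply: (@cvgM R V (nbhs x)); last exact: cvg_cst.
  exact: (@coord_continuous R 1 d 0 i x).
apply/funext => x; rewrite {1}[x]row_sum_delta linear_sum /=.
by apply: eq_bigr => i _; rewrite linearZ.
Qed.

Lemma continuous_affine f : affine_linear f -> continuous f.
Proof.
move=> [l [b fE]]; rewrite (_ : f = fun x => l x + b); last exact/funext.
move=> x; apply: (@cvgD R R V (nbhs x)); last exact: cvg_cst.
exact: (@continuous_scalar l x).
Qed.

Lemma continuous_hinge h : hinge_function h -> continuous h.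
Proof.
move=> [s [t [L [st LA hE]]]].
rewrite (_ : h = fun x => L 0%N x + \sum_(1 <= i < s.+1) `|L i x| -
  \sum_(s.+1 <= j < t.+1) `|L j x|); last exact/funext.
have normL i : (i <= t)%N -> continuous (fun x => `|L i x|).
  move=> it x; apply: (@cvg_norm R R V (nbhs x)).
  exact: (@continuous_affine (L i) (LA _ it) x).
have sumL m n : (n <= t)%N -> continuous (fun x => \sum_(m <= i < n.+1) `|L i x|).
  move=> nt; under eq_fun do rewrite big_nat.
  apply: continuous_big => [|i /andP[_ /= iP]]; first exact: add_continuous.
  exact/normL/(leq_trans _ nt).
move=> x; apply: (@cvgB R R V (nbhs x)); last exact: (sumL _ _ _ x).
apply: (@cvgD R R V (nbhs x)); last exact: (sumL _ _ _ x).
exact: (@continuous_affine _ (LA _ _) x).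
Qed.

Lemma open_polytope_open (A : set V) : open_polytope A -> open A.
Proof.
move=> [F [/finite_seqP[r ->] rH ->]]; rewrite bigcap_seq big_seq.
apply: big_ind => [|A1 A2|H Hr]; [exact: openT|exact: openI|].
have [l [b [_ ->]]] := rH H Hr.
apply: (@open_comp _ _ (fun x => l x + b) [set y | 0 < y]) => [x _|].
  by apply: (@continuous_affine (fun x => l x + b)); exists l, b.
exact: open_gt.
Qed.

Lemma polytopal_set_open (A : set V) : polytopal_set A -> open A.
Proof.
move=> [F [_ FP ->]]; apply: bigcup_open => P /FP; exact: open_polytope_open.
Qed.

Lemma open_positivity h : hinge_function h -> open (positivity_set h).
Proof.
move=> hh; apply: (@open_comp _ _ h [set y | 0 < y]) => [x _|].
  exact: continuous_hinge.
exact: open_gt.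
Qed.

(** The positivity set is open, so it misses its boundary and [h p <= 0]; its closure lies in the
    closed set [0 <= h]. *)
Lemma boundary_positivity h p : hinge_function h ->
  boundary (positivity_set h) p -> h p = 0.
Proof.
move=> hh [cp]; rewrite (interior_id _).1; last exact: open_positivity.
move=> np; apply/eqP; rewrite eq_le leNgt; apply/andP; split; first exact/negP.
have cl : closed (h @^-1` [set y | 0 <= y]).
  apply: closed_comp; last exact: closed_ge.
  by move=> x _; exact: continuous_hinge.
suff: (h @^-1` [set y | 0 <= y]) p by [].
by rewrite ((closure_id _).1 cl); apply: (closureS _ cp) => y /ltW.
Qed.

Lemma nbhs_line (p v : V) (U : set V) : nbhs p U ->
  exists2 e : R, 0 < e & forall t, `|t| < e -> U (p + t *: v).
Proof.
move=> pU; have : (p + t *: v) @[t --> (0 : R)] --> p.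
  rewrite -[X in _ --> X]addr0 -(scale0r v).
  by apply: cvgD; [exact: cvg_cst|apply: cvgZr_tmp; exact: cvg_id].
move=> /(_ _ pU) /nbhs_ballP[e /= e0 eU]; exists e => // t te.
by apply: eU; rewrite /ball /= sub0r normrN.
Qed.

Lemma closureZ (A : set V) (k : R) (p : V) : 0 < k ->
  (forall q, A q -> A (k *: q)) -> closure A p -> closure A (k *: p).
Proof.
move=> k0 AZ cp U kU; have : (k *: q) @[q --> p] --> k *: p.
  by apply: (@cvgZl_tmp R V V (nbhs p)); exact: cvg_id.
by move=> /(_ _ kU) /cp[q [Aq Uq]]; exists (k *: q); split => //; exact: AZ.
Qed.

Lemma convex_hull_halfspace (g : V -> R) (A : set V) : scalar g ->
  A `<=` [set x | 0 < g x] -> convex_hull A `<=` [set x | 0 < g x].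
Proof.
move=> /scalar_ex[l /funext <-] Ag; apply: smallest_sub => //; apply/convex_setW.
move=> x y; rewrite !inE => /= lx ly k k0 k1.
rewrite inE; change (0 < l (k%:num *: (x : V) + (1 - k%:num) *: (y : V))).
rewrite linearD !linearZ /=; apply: addr_gt0; apply: mulr_gt0 => //.
by rewrite subr_gt0.
Qed.

Lemma linear_span_kernel (g : V -> R) (A : set V) : scalar g ->
  A `<=` [set x | g x = 0] -> linear_span A `<=` [set x | g x = 0].
Proof.
move=> /scalar_ex[l /funext <-] Ag; apply: smallest_sub => //; split.
  by rewrite inE /= linear0.
by move=> k x y; rewrite !inE /= linearP /= => -> ->; rewrite mulr0 addr0.
Qed.

Lemma convex_hull_combination (A : set V) (x y : V) (k : R) : 0 < k < 1 ->
  convex_hull A x -> convex_hull A y -> convex_hull A (k *: x + (1 - k) *: y).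
Proof.
move=> /andP[k0 k1] Ax Ay B [Bc AB].
have := Bc x y (Itv01 (ltW k0) (ltW k1)).
rewrite !inE; apply; [exact: Ax|exact: Ay].
Qed.

End Hinges.

(** * Cones, their slices along lines, and necessity of the condition *)

Section Cones.
Variables (R : realType) (d : nat).
Local Notation V := 'rV[R]_d.
Implicit Types (x p v : V) (C : set V).

Lemma constant_offS (T : Type) (S S' : seq R) (v : R -> T) :
  {subset S <= S'} -> constant_off S v -> constant_off S' v.
Proof. by move=> SS' vS x y xy H; apply: vS => // z /SS'; apply: H. Qed.

Lemma constant_off_all (T : choiceType) (F : set T) (P : T -> R -> Prop) :
  finite_set F -> (forall i, F i -> exists S, constant_off S (P i)) ->
  exists S, forall i, F i -> constant_off S (P i).
Proof.
move=> /finite_seqP[r ->]; elim: r => [|i r IH] H; first by exists [::].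
have [|S HS] := IH; first by move=> j jr; apply: H; rewrite /= inE (jr : j \in r) orbT.
have [|Si HSi] := H i; first exact: mem_head.
exists (Si ++ S) => j /=; rewrite inE => /orP[/eqP ->|/HS].
  by apply: constant_offS HSi => z; rewrite mem_cat => ->.
by apply: constant_offS => z; rewrite mem_cat orbC => ->.
Qed.

Lemma halfspace_slice C p v : open_halfspace C ->
  exists S, constant_off S (fun t : R => C (p + t *: v)).
Proof.
(* If [l v = 0], the quotient is the junk value 0 and the slice is constant anyway. *)
move=> [l [b [_ ->]]]; pose r := - (l p + b) / l v.
have E t : l (p + t *: v) + b = (l p + b) + t * l v.
  by rewrite linearD linearZ /= addrAC.
exists [:: r] => x y xy /(_ r (mem_head _ _)) H; rewrite /= !E.
have [v0|v0|v0] := ltgtP (l v) 0; last by rewrite v0 !mulr0.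
  have e t : (0 < l p + b + t * l v) = (t < r).
    by rewrite /r ltr_ndivlMr //; apply/idP/idP; lra.
  by rewrite !e; congr is_true; apply/idP/idP; lra.
have e t : (0 < l p + b + t * l v) = (r < t).
  by rewrite /r ltr_pdivrMr //; apply/idP/idP; lra.
by rewrite !e; congr is_true; apply/idP/idP; lra.
Qed.

Lemma polytopal_slice C p v : polytopal_set C ->
  exists S, constant_off S (fun t : R => C (p + t *: v)).
Proof.
move=> [F [Ff FP ->]].
have [P /FP [G [Gf GH ->]]|S HS] :=
    @constant_off_all _ F (fun P t => P (p + t *: v)) Ff.
  have [H /GH HH|S HS] := @constant_off_all _ G (fun H t => H (p + t *: v)) Gf.
    exact: halfspace_slice.
  exists S => x y xy nS; apply/propext.
  by split=> K H GH'; have := K H GH'; rewrite (HS _ GH' _ _ xy nS).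
exists S => x y xy nS; apply/propext.
by split=> -[P FP' PP]; exists P => //; move: PP; rewrite (HS _ FP' _ _ xy nS).
Qed.

Lemma open_slice C p v (tau : R) : open C -> C (p + tau *: v) ->
  exists2 e : R, 0 < e & forall t, `|t - tau| < e -> C (p + t *: v).
Proof.
move=> Co Cp; have [e e0 He] := @nbhs_line R d _ v _ (open_nbhs_nbhs (conj Co Cp)).
by exists e => // t /He; rewrite -addrA -scalerDl subrKC.
Qed.

Lemma adherent_slice_closure C p v (P : R -> Prop) (tau : R) :
  adherent P tau -> (forall t, P t -> C (p + t *: v)) -> closure C (p + tau *: v).
Proof.
move=> adh PC U /(@nbhs_line R d _ v)[e e0 He]; have [t te Pt] := adh _ e0.
exists (p + t *: v); split; first exact: PC.
by have := He _ te; rewrite -addrA -scalerDl subrKC.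
Qed.

Definition cone C : Prop :=
  forall p (lambda : R), C p -> 0 < lambda -> C (lambda *: p).

Lemma coneZE C p (k : R) : cone C -> 0 < k -> C (k *: p) <-> C p.
Proof.
move=> CC k0; split=> [Ckp|Cp]; last exact: CC.
have := CC _ k^-1 Ckp; rewrite scalerA mulVf ?lt0r_neq0 // scale1r invr_gt0.
exact.
Qed.

Lemma cone_RZ C p (k : R) : cone C -> 0 < k -> cone_R C (k *: p) <-> cone_R C p.
Proof.
by move=> CC k0; rewrite /cone_R /= -scalerN; split=> -[]; rewrite !coneZE.
Qed.

Lemma boundary_coneZ C p (k : R) : cone C -> open C -> 0 < k ->
  boundary C p -> boundary C (k *: p).
Proof.
move=> CC Co k0; rewrite /boundary ((interior_id _).1 Co) => -[cp np]; split.
  by apply: closureZ cp => // q Cq; exact: CC.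
by rewrite /= coneZE.
Qed.

(** Openness puts a small positive multiple of every [x] in [C], and the cone property scales it
    back. *)
Lemma cone_with_origin C : cone C -> open C -> C 0 -> C = setT.
Proof.
move=> CC Co C0; apply/seteqP; split=> // x _.
have [|e e0 He] := @open_slice C 0 x 0 Co; first by rewrite scale0r addr0.
have := He (e / 2); rewrite subr0 add0r coneZE ?divr_gt0 //; apply.
by rewrite gtr0_norm; lra.
Qed.

Lemma hinge_separated C h : cone C -> hinge_function h ->
  C = positivity_set h -> linear_span (cone_G C) `&` convex_hull (cone_R C) = set0.
Proof.
move=> CC hh CE; have Co : open C by rewrite CE; exact: open_positivity.
have [g gS gE] := hinge_odd_germ hh.
(* Scaling moves every vector into the range where the odd part is linear; [C] and its boundary are
   stable under it. *)
have half x : exists2 e : R, 0 < e & h (e *: x) - h (- (e *: x)) = e * g x.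
  by have [e e0 He] := gE x; exists (e / 2); [lra|apply: He; lra].
apply/seteqP; split=> // x [xG xR].
have /= : g x = 0.
  apply: (linear_span_kernel gS _ xG) => p [bp bn] /=.
  have [e e0] := half p.
  rewrite (@boundary_positivity _ _ h (e *: p)) -?CE; last 2 first.
  - by [].
  - exact: boundary_coneZ.
  rewrite (@boundary_positivity _ _ h (- (e *: p))) -?CE //; last first.
    by rewrite -scalerN; exact: boundary_coneZ.
  by rewrite subrr => /esym/eqP; rewrite mulf_eq0 gt_eqF //= => /eqP.
suff /= : 0 < g x by move=> + gx; rewrite gx ltxx.
apply: (convex_hull_halfspace gS _ xR) => p [Cp nCp] /=.
have [e e0] := half p.
have : 0 < h (e *: p) by have := CC _ _ Cp e0; rewrite CE.
have : h (- (e *: p)) <= 0.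
  by rewrite leNgt; apply/negP => H; apply: nCp;
    rewrite -(coneZE _ CC e0) scalerN CE.
by move=> h1 h2 h3; rewrite -(pmulr_rgt0 _ e0) -h3; lra.
Qed.

Lemma linear_span_sub (A : set V) x : A x -> linear_span A x.
Proof. by move=> Ax; exact: sub_gen_smallest. Qed.

Lemma linear_spanP (A : set V) (k : R) x y :
  linear_span A x -> linear_span A y -> linear_span A (k *: x + y).
Proof.
move=> Ax Ay W [[W0 Wlin] AW]; apply/set_mem/Wlin; apply/mem_set.
  by apply: Ax.
by apply: Ay.
Qed.

Lemma linear_spanZ (A : set V) (k : R) x : linear_span A x -> linear_span A (k *: x).
Proof.
move=> Ax; rewrite -[_ *: x]addr0; apply: linear_spanP => // W [[/set_mem W0 _] _].
exact: W0.
Qed.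

End Cones.

(** * Construction of the hinge function in the plane *)

Section Plane.
Variable R : realType.
Local Notation V := 'rV[R]_2.
Implicit Types (a b x : V) (l u : V -> R) (C : set V).

(** A basis [a], [b] of the plane with its dual basis [l], [u]. *)
Definition frame a b l u : Prop :=
  [/\ scalar l, scalar u, forall x, x = l x *: a + u x *: b,
      l a = 1 /\ l b = 0 & u a = 0 /\ u b = 1].

Lemma frame_ex a : a != 0 -> exists b l u, frame a b l u.
Proof.
move=> a0; pose N := a 0 0 ^+ 2 + a 0 1 ^+ 2.
have ord2 (P : 'I_2 -> Prop) : P 0 -> P 1 -> forall j, P j.
  move=> P0 P1 [[|[|//]] jP]; [rewrite (_ : Ordinal jP = 0)//|
    rewrite (_ : Ordinal jP = 1)//]; exact: val_inj.
have N0 : N != 0.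
  apply: contra a0; rewrite paddr_eq0 ?sqr_ge0 // !sqrf_eq0 => /andP[/eqP h0 /eqP h1].
  by apply/eqP/rowP; apply: ord2; rewrite mxE.
(* [b] is [a] turned by a right angle, so the coordinates are inner products divided by [N]. *)
pose b : V := \row_j (if j == 0 then - a 0 1 else a 0 0).
have b0 : b 0 0 = - a 0 1 by rewrite mxE.
have b1 : b 0 1 = a 0 0 by rewrite mxE.
exists b, (fun x => (x 0 0 * a 0 0 + x 0 1 * a 0 1) / N),
  (fun x => (x 0 1 * a 0 0 - x 0 0 * a 0 1) / N); split.
- by move=> k x y; rewrite !mxE; field.
- by move=> k x y; rewrite !mxE; field.
- by move=> x; apply/rowP; apply: ord2; rewrite !mxE /=; move: N0;
    rewrite /N => N0; field.
- by rewrite b0 b1; split; move: N0; rewrite /N => N0; field.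
- by rewrite b0 b1; split; move: N0; rewrite /N => N0; field.
Qed.

Lemma frameC a b l u : frame a b l u -> frame b a u l.
Proof.
by move=> [lS uS E [la lb] [ua ub]]; split=> // x; rewrite addrC -E.
Qed.

Lemma frameN a b l u : frame a b l u -> frame (- a) b (fun x => - l x) u.
Proof.
move=> [lS uS E [la lb] [ua ub]].
have N g x : scalar g -> g (- x) = - g x.
  by move=> /scalar_ex[m mE]; rewrite -!mE linearN.
split=> // [k x y|x||]; rewrite ?N ?la ?lb ?ua ?opprK ?oppr0 //.
  by rewrite lS; ring.
by rewrite scalerN scaleNr opprK -E.
Qed.

Lemma frame_shear a b l u (c : R) : frame a b l u ->
  frame a (b - c *: a) (fun x => l x + c * u x) u.
Proof.
move=> [lS uS E [la lb] [ua ub]].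
have B g : scalar g -> g (b - c *: a) = g b - c * g a.
  by move=> /scalar_ex[m mE]; rewrite -!mE linearB linearZ.
split=> // [k x y|x||].
- by rewrite lS uS; ring.
- by rewrite {1}[x]E scalerBr scalerA [u x * c]mulrC scalerDl addrACA subrr addr0.
- by rewrite !B // la ua lb ub; split; ring.
- by rewrite B // ua ub; split => //; ring.
Qed.

(* [|l x| * abs_comb c s (u x / l x)] is a combination of absolute values of
   linear forms that extends to the line [l = 0]. *)
Lemma hinge_of_profile C a b l u (k c : R) (s : seq (R * R)) :
  frame a b l u -> cone C -> ~ C 0 ->
  (forall t, - k < abs_comb c s t <-> C (a + t *: b)) ->
  (forall t, k < abs_comb c s t <-> C (- (a + t *: b))) ->
  (0 < slope s <-> C b) -> (C b <-> C (- b)) ->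
  exists h, hinge_function h /\ C = positivity_set h.
Proof.
move=> [lS uS E _ _] CC C0 posC negC slopeC Csym.
pose S : seq (R * (V -> R)) :=
  (c, l) :: [seq (p.1, fun x => u x - p.2 * l x) | p <- s].
have scA g : scalar g -> affine_linear g.
  by move=> /scalar_ex[m mE]; exists m, 0 => x; rewrite mE addr0.
exists (fun x => k * l x + \sum_(p <- S) p.1 * `|p.2 x|); split.
  apply: hinge_comb => [|p]; first by apply: scA => z x y; rewrite lS; ring.
  rewrite inE => /orP[/eqP ->|/mapP[[y t] _ ->]]; first exact: scA.
  by apply: scA => z x x'; rewrite /= lS uS; ring.
have sumE x : l x != 0 ->
    \sum_(p <- S) p.1 * `|p.2 x| = `|l x| * abs_comb c s (u x / l x).
  move=> l0; rewrite big_cons big_map /abs_comb mulrDr [c * _]mulrC.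
  congr (_ + _); rewrite big_distrr; apply: eq_bigr => p _ /=.
  by rewrite mulrCA -normrM mulrBr mulrCA divff // mulr1 [p.2 * _]mulrC.
suff EC x : C x <-> 0 < k * l x + \sum_(p <- S) p.1 * `|p.2 x|.
  by apply/seteqP; split=> x; rewrite /positivity_set /= EC.
have lE : l x != 0 -> x = l x *: (a + (u x / l x) *: b).
  by move=> l0; rewrite scalerDr scalerA mulrC divfK // -E.
have [ln|lp|l0] := ltgtP (l x) 0.
(* Here [x] is a positive multiple of the opposite of a point of the line [l = 1]; the term
   [k * l x] is negative, which turns the threshold [- k] into [k]. *)
- have l0 : l x != 0 by rewrite lt_eqF.
  rewrite sumE // ltr0_norm // {1}(lE l0) -[l x in X in C X]opprK scaleNr -scalerN.
  rewrite coneZE ?oppr_gt0 // -negC opprK -subr_gt0.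
  rewrite (_ : k * l x + _ = - l x * (abs_comb c s (u x / l x) - k)); last by ring.
  by rewrite pmulr_rgt0 ?oppr_gt0 //; split.
- have l0 : l x != 0 by rewrite gt_eqF.
  rewrite sumE // gtr0_norm // {1}(lE l0) coneZE // -posC -subr_gt0 opprK.
  rewrite (_ : k * l x + _ = l x * (abs_comb c s (u x / l x) + k)); last by ring.
  by rewrite pmulr_rgt0 //; split.
(* On [l = 0] only the terms in [|u|] survive, with total weight [slope s]. *)
have -> : k * l x + \sum_(p <- S) p.1 * `|p.2 x| = `|u x| * slope s.
  rewrite big_cons big_map /= l0 normr0 !mulr0 !add0r big_distrr /=.
  by apply: eq_bigr => p _; rewrite mulr0 subr0 mulrC.
have xE : x = u x *: b by rewrite {1}[x]E l0 scale0r add0r.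
have [un|up|u0] := ltgtP (u x) 0.
- rewrite pmulr_rgt0 ?normr_gt0 ?lt_eqF // slopeC Csym {1}xE.
  by rewrite -[u x]opprK scaleNr -scalerN coneZE ?oppr_gt0 //; split.
- by rewrite pmulr_rgt0 ?normr_gt0 ?gt_eqF // slopeC {1}xE coneZE //; split.
by rewrite u0 normr0 mul0r ltxx xE u0 scale0r; split.
Qed.

(** For large [|t|], [a + t *: b] is a positive multiple of [b] or [- b] perturbed by [|t|^-1 *: a],
    and openness absorbs the perturbation. *)
Lemma cone_large_slices C a b : cone C -> open C -> C b -> C (- b) ->
  exists2 M : R, 0 < M & forall t, M < `|t| -> C (a + t *: b).
Proof.
move=> CC Co Cb CNb.
have [|e e0 He] := @open_slice R 2 C b a 0 Co; first by rewrite scale0r addr0.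
have [|f f0 Hf] := @open_slice R 2 C (- b) a 0 Co; first by rewrite scale0r addr0.
exists (e^-1 + f^-1) => [|t Mt]; first by rewrite addr_gt0 ?invr_gt0.
have t0 : 0 < `|t|.
  by apply: le_lt_trans Mt; rewrite addr_ge0 ?invr_ge0 ?ltW.
have te : `|t|^-1 < e.
  rewrite -[e]invrK ltf_pV2 ?posrE ?invr_gt0 //.
  by apply: le_lt_trans Mt; rewrite lerDl invr_ge0 ltW.
have tf : `|t|^-1 < f.
  rewrite -[f]invrK ltf_pV2 ?posrE ?invr_gt0 //.
  by apply: le_lt_trans Mt; rewrite lerDr invr_ge0 ltW.
have nt : `|(`|t|^-1 : R)| = `|t|^-1 by rewrite ger0_norm ?invr_ge0.
have := @coneZE _ _ C _ `|t| CC t0.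
have [tp|tn|t00] := ltgtP t 0; last by rewrite t00 normr0 ltxx in t0.
  have /(coneZE _ CC t0) : C (- b + `|t|^-1 *: a) by apply: Hf; rewrite subr0 nt.
  by rewrite scalerDr scalerA divff ?gt_eqF // scale1r addrC ltr0_norm //
    scalerN scaleNr opprK.
have /(coneZE _ CC t0) : C (b + `|t|^-1 *: a) by apply: He; rewrite subr0 nt.
by rewrite scalerDr scalerA divff ?gt_eqF // scale1r addrC gtr0_norm.
Qed.

(** A profile of slope 0 is right on the line [l = 0] only if [b] is outside [C]. Otherwise
    [a + t *: b] and its opposite both lie in [C] for large [|t|], and a nonnegative tail added
    there changes no comparison with [k] or [- k]. *)
Lemma hinge_of_bounded_profile C a b l u (k c : R) (s : seq (R * R)) :
  frame a b l u -> cone C -> open C -> ~ C 0 -> slope s = 0 ->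
  (forall t, - k < abs_comb c s t <-> C (a + t *: b)) ->
  (forall t, k < abs_comb c s t <-> C (- (a + t *: b))) ->
  (C b <-> C (- b)) ->
  exists h, hinge_function h /\ C = positivity_set h.
Proof.
move=> fr CC Co C0 s0 posC negC Csym; have [Cb|nCb] := pselect (C b); last first.
  by apply: hinge_of_profile fr CC C0 posC negC _ Csym; rewrite s0 ltxx; split.
have CNb : C (- b) by apply/Csym.
have [M1 M10 HM1] := cone_large_slices a CC Co Cb CNb.
have [|M2 M20 HM2] := cone_large_slices (- a) CC Co CNb _; first by rewrite opprK.
have [c' [s' [s'1 T0 Tp]]] := abs_comb_tail (addr_gt0 M10 M20).
apply: (@hinge_of_profile C a b l u k (c + c') (s ++ s')) => // [t|t|].
- rewrite -abs_combD -posC; have [tM|Mt] := leP `|t| (M1 + M2).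
    by rewrite T0 // addr0.
  have /posC h : C (a + t *: b) by apply: HM1; lra.
  by have := Tp t; split=> _ //; lra.
- rewrite -abs_combD -negC; have [tM|Mt] := leP `|t| (M1 + M2).
    by rewrite T0 // addr0.
  have /negC h : C (- (a + t *: b)).
    by rewrite opprD -scalerN; apply: HM2; lra.
  by have := Tp t; split=> _ //; lra.
- by rewrite slopeD s0 s'1 add0r; split=> // _; exact: ltr01.
Qed.

(** The indicator of [C] on an affine line is interpolated: inside [C] the positive weight gives a
    positive value, outside it openness forces [v tau = 0]. By symmetry one profile serves both
    half-planes. *)
Lemma symmetric_cone_hinge C : polytopal_set C -> cone C -> ~ C 0 ->
  (forall p, C p -> C (- p)) ->
  exists h, hinge_function h /\ C = positivity_set h.
Proof.
move=> Cpoly CC C0 Csym; have Co := polytopal_set_open Cpoly.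
have symE p : C (- p) <-> C p by split=> /Csym //; rewrite opprK.
have [|b [l [u fr]]] := @frame_ex (const_mx 1).
  by apply/eqP => /rowP/(_ 0); rewrite !mxE => /eqP; rewrite oner_eq0.
set a := const_mx 1 in fr.
have [S HS] := polytopal_slice a b Cpoly.
pose v (t : R) : R := if `[< C (a + t *: b) >] then 1 else 0.
have [|c [s [s0 intp]]] := @interpolation R S v.
  by move=> x y xy nS; rewrite /v (HS _ _ xy nS).
have posE t : 0 < abs_comb c s t <-> C (a + t *: b).
  have [tau [lam [lam01 -> adh]]] := intp t; split=> [|Ct].
    apply: contraPP => nCt; rewrite [v t]/v asboolF // mulr0 add0r.
    rewrite /v; case: asboolP => [Ctau|_]; last by rewrite mulr0 ltxx.
    have [e e0 He] := open_slice Co Ctau; have [y /He Cy] := adh _ e0.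
    by rewrite /v asboolT // asboolF // => /eqP; rewrite oner_eq0.
  rewrite [v t]/v asboolT //.
  have : 0 <= v tau by rewrite /v; case: asboolP.
  by move=> h; have := mulr_ge0 (_ : 0 <= 1 - lam) h; lra.
by apply: (hinge_of_bounded_profile fr CC Co C0 s0 (k := 0)) => [t|t|];
  rewrite ?oppr0 ?posE ?symE.
Qed.

Lemma one_sided_cone_hinge C a b l u : polytopal_set C -> cone C -> ~ C 0 ->
  frame a b l u -> (forall p, cone_G C p -> l p = 0) ->
  (forall p, cone_R C p -> 0 < l p) ->
  exists h, hinge_function h /\ C = positivity_set h.
Proof.
move=> Cpoly CC C0 fr lG lR; have Co := polytopal_set_open Cpoly.
have [lS _ _ [la lb] _] := fr; have [m mE] := scalar_ex lS.
have lE t : l (a + t *: b) = 1.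
  by rewrite -mE linearD linearZ /= !mE la lb mulr0 addr0.
have lN p : l (- p) = - l p by rewrite -!mE linearN.
have notR p : l p <= 0 -> C p -> C (- p).
  move=> lp Cp; apply: contrapT => nCp; have := lR p (conj Cp nCp); lra.
have NC t : C (- (a + t *: b)) -> C (a + t *: b).
  by move=> /notR; rewrite lN lE opprK; apply; lra.
(* [b] lies on the line [l = 0], where [cone_R C] has no points. *)
have Csym : C b <-> C (- b).
  split=> /notR; rewrite ?lN lb ?oppr0 ?opprK; exact.
have [S HS] := polytopal_slice a b Cpoly.
have [S' HS'] := polytopal_slice (- a) (- b) Cpoly.
pose A t := C (- a + t *: - b); pose B t := C (a + t *: b).
have AE t : C (- (a + t *: b)) <-> A t by rewrite /A opprD scalerN.
have AB t : A t -> B t by move=> /AE /NC.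
(* As [A] is contained in [B], three levels suffice; a positive weight on 2 against 1 stays above 1,
   and on 1 against -1 stays above -1. *)
pose v (t : R) : R := if `[< A t >] then 2 else if `[< B t >] then 1 else -1.
have vA t : A t -> v t = 2 by move=> At; rewrite /v asboolT.
have vB t : ~ A t -> B t -> v t = 1.
  by move=> At Bt; rewrite /v asboolF // asboolT.
have vD t : ~ B t -> v t = -1.
  by move=> Bt; rewrite /v asboolF => [|/AB//]; rewrite asboolF.
have [|c [s [s0 intp]]] := @interpolation R (S ++ S') v.
  move=> x y xy nS; rewrite /v /A /B.
  have -> : C (a + x *: b) = C (a + y *: b).
    by apply: HS xy _ => z zS; apply: nS; rewrite mem_cat zS.
  have -> // : C (- a + x *: - b) = C (- a + y *: - b).
  by apply: HS' xy _ => z zS; apply: nS; rewrite mem_cat zS orbT.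
have key t : [/\ A t -> 1 < abs_comb c s t,
    ~ A t -> B t -> -1 < abs_comb c s t <= 1 & ~ B t -> abs_comb c s t <= -1].
  have [tau [lam [lam01 -> adh]]] := intp t; split.
  - move=> At; rewrite (vA _ At).
    (* Otherwise [a + tau *: b] and its opposite are outside [C] but adherent to it, which puts the
       point in [cone_G C] although [l] is 1 there. *)
    have Btau : B tau.
      apply: contrapT => nB.
      have adhA : adherent A tau.
        move=> e /adh[y ye vy]; exists y => //; apply: contrapT => nA.
        by move: vy; rewrite (vA _ At) /v asboolF //; case: asboolP => _; lra.
      have : cone_G C (a + tau *: b).
        split; split; rewrite /interior.
        - by apply: adherent_slice_closure adhA _ => y /AB.
        - by move=> /nbhs_singleton.
        - rewrite opprD -scalerN.
          by apply: adherent_slice_closure adhA _ => y.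
        - by move=> /nbhs_singleton /NC.
      by move=> /lG; rewrite lE => /eqP; rewrite oner_eq0.
    have [At'|nAt'] := pselect (A tau); first by rewrite (vA _ At'); lra.
    by rewrite (vB _ nAt' Btau); lra.
  - move=> nAt Bt; rewrite (vB _ nAt Bt).
    have [Bt'|nBt'] := pselect (B tau); last by rewrite (vD _ nBt'); lra.
    have [At'|nAt'] := pselect (A tau); last by rewrite (vB _ nAt' Bt'); lra.
    (* [A] is open, so all levels near a point of [A] are 2 and none is the level 1 of [t]. *)
    have [e e0 He] := open_slice Co At'; have [y /He Ay] := adh _ e0.
    by rewrite (vA _ Ay) (vB _ nAt Bt); lra.
  - move=> nBt; rewrite (vD _ nBt).
    have [Bt'|nBt'] := pselect (B tau); last by rewrite (vD _ nBt'); lra.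
    have [e e0 He] := open_slice Co Bt'; have [y /He By] := adh _ e0.
    have [Ay|nAy] := pselect (A y); first by rewrite (vA _ Ay) (vD _ nBt); lra.
    by rewrite (vB _ nAy By) (vD _ nBt); lra.
apply: (hinge_of_bounded_profile fr CC Co C0 s0 (k := 1)) => [t|t|//].
- have [kA kB kD] := key t.
  have [Bt|nBt] := pselect (B t); last by split=> // h; have := kD nBt; lra.
  split=> // _; have [At|nAt] := pselect (A t); first by have := kA At; lra.
  by have := kB nAt Bt; lra.
- have [kA kB kD] := key t; rewrite AE.
  have [At|nAt] := pselect (A t); first by split=> // _; exact: kA.
  split=> // h; have [Bt|nBt] := pselect (B t); first by have := kB nAt Bt; lra.
  by have := kD nBt; lra.
Qed.

End Plane.

(** * Linear forms vanishing on [cone_G C] and positive on [cone_R C] *)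

Section Separation.
Variable R : realType.
Local Notation V := 'rV[R]_2.
Implicit Types (C : set V) (l u : V -> R).

(* The last two hypotheses exclude the only obstruction to strictness: a common
   bound [sup F = inf G] that is attained. *)
Lemma strict_cut (F G : set R) (M : R) : 0 < M ->
  (forall f, F f -> f <= M) -> (forall g, G g -> - M <= g) ->
  (forall f g, F f -> G g -> f < g) ->
  (forall f, F f -> exists2 e : R, 0 < e & forall g, G g -> e <= `|g - f|) ->
  (forall g, G g -> exists2 e : R, 0 < e & forall f, F f -> e <= `|g - f|) ->
  exists c, (forall f, F f -> f < c) /\ (forall g, G g -> c < g).
Proof.
(* The added point lies below all of [G] and makes the supremum exist even for empty [F]. *)
move=> M0 FM GM FG Fgap Ggap; pose F' := F `|` [set - M - 1].
have supF : has_sup F'.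
  split; first by exists (- M - 1); right.
  by exists M => f [/FM//|->]; lra.
pose c := sup F'; have F'c f : F' f -> f <= c by move: f; exact: sup_upper_bound.
have cG g : G g -> c <= g.
  move=> Gg; apply: ge_sup; first exact: supF.1.
  by move=> f [Ff|->]; [apply: ltW; exact: FG|have := GM _ Gg; lra].
(* If the supremum is attained, the cut moves up by half a gap; otherwise it is the supremum
   itself. *)
have [[Fc|cE]|nF'c] := pselect (F' c).
- have [e e0 He] := Fgap _ Fc; exists (c + e / 2); split=> [f Ff|g Gg].
    by have := F'c f (or_introl Ff); lra.
  by have := cG _ Gg; have := He _ Gg => /[swap] h; rewrite ger0_norm; lra.
- exists (c + 1 / 2); split=> [f Ff|g Gg].
    by have := F'c f (or_introl Ff); lra.
  by have := GM _ Gg; have : c = - M - 1 := cE; lra.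
exists c; split=> [f Ff|g Gg].
  rewrite lt_neqAle F'c ?andbT; last by left.
  by apply/eqP => fc; apply: nF'c; left; rewrite -fc.
rewrite lt_neqAle cG // andbT; apply/eqP => cg; rewrite -cg in Gg.
have [e e0 He] := Ggap _ Gg.
(* The bound 1 excludes the added point [- M - 1], since here [- M <= c]. *)
have m0 : 0 < Num.min e 1 by rewrite lt_min e0 ltr01.
have [f [Ff|->]] := sup_adherent m0 supF; rewrite -/c => fc.
  have := He _ Ff; have := F'c f (or_introl Ff).
  have : Num.min e 1 <= e by rewrite ge_min lexx.
  by move=> h1 h2; rewrite ger0_norm; lra.
have : Num.min e 1 <= 1 by rewrite ge_min lexx orbT.
by have := GM _ Gg; lra.
Qed.

(** The span contains the line of [b]. Were [l] nonzero somewhere on [cone_G C], the span would be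
    the plane and meet [cone_R C]; were [l] zero somewhere or of both signs on [cone_R C], the hull
    would meet the line of [b]. So [l] or [- l] works. *)
Lemma separate_line C a b l u : frame a b l u -> cone_G C b ->
  cone_R C !=set0 -> linear_span (cone_G C) `&` convex_hull (cone_R C) = set0 ->
  exists a' l', [/\ frame a' b l' u, forall p, cone_G C p -> l' p = 0 &
    forall p, cone_R C p -> 0 < l' p].
Proof.
move=> fr Gb [r Rr] disj; have [lS uS E _ _] := fr.
have hullR p : cone_R C p -> convex_hull (cone_R C) p.
  by move=> Rp; exact: sub_gen_smallest.
have apart p : convex_hull (cone_R C) p -> ~ linear_span (cone_G C) p.
  by move=> hp sp; rewrite -[False]/(set0 p) -disj.
have spanb k : linear_span (cone_G C) (k *: b).
  by apply: linear_spanZ; exact: linear_span_sub.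
have lG p : cone_G C p -> l p = 0.
  move=> Gp; apply/eqP; apply: contrapT => /negP lp.
  have spana : linear_span (cone_G C) a.
    rewrite (_ : a = (l p)^-1 *: p + (- (l p)^-1 * u p) *: b).
      by apply: linear_spanP (spanb _); exact: linear_span_sub.
    by rewrite {2}[p]E scalerDr !scalerA mulVf // scale1r mulNr scaleNr addrK.
  apply: (apart _ (hullR _ Rr)); rewrite [r]E.
  exact: linear_spanP spana (spanb _).
have lR p : cone_R C p -> l p != 0.
  move=> Rp; apply/eqP => lp; apply: (apart _ (hullR _ Rp)).
  by rewrite [p]E lp scale0r add0r.
have opposite p q : cone_R C p -> cone_R C q -> 0 < l p -> l q < 0 -> False.
  (* The weight at which the segment between [p] and [q] crosses the line [l = 0]. *)
  move=> Rp Rq lp lq; pose k := - l q / (l p - l q).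
  have d0 : 0 < l p - l q by lra.
  have k01 : 0 < k < 1.
    by rewrite divr_gt0 ?oppr_gt0 //= ltr_pdivrMr // mul1r; lra.
  apply: (apart _ (convex_hull_combination k01 (hullR _ Rp) (hullR _ Rq))).
  set z := _ + _; have -> // : z = u z *: b.
  rewrite {1}[z]E (_ : l z = 0) ?scale0r ?add0r //.
  have [m mE] := scalar_ex lS.
  rewrite /z lS -(mE ((1 - k) *: q)) linearZ /= mE /k.
  by field; rewrite gt_eqF.
have [lr|lr|/eqP] := ltgtP (l r) 0; last by rewrite (negPf (lR _ Rr)).
  exists (- a), (fun x => - l x); split=> [|p /lG ->|p Rp].
  - exact: frameN.
  - exact: oppr0.
  - rewrite oppr_gt0 ltNge le_eqVlt eq_sym (negPf (lR _ Rp)) /=.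
    by apply/negP => lp; exact: opposite Rp Rr lp lr.
exists a, l; split=> // p Rp.
rewrite ltNge le_eqVlt (negPf (lR _ Rp)) /=.
by apply/negP => lp; exact: opposite Rr Rp lr lp.
Qed.

(** Off the line [u = 0], positivity of [l + c u] on [cone_R C] says that [c] lies strictly between
    the traces [F] and [G] of [cone_R C] on [u = 1] and [u = -1]; on [u = 0] it follows from [- a]
    being outside [C]. *)
Lemma separate_origin C a b l u : cone C -> open C -> frame a b l u ->
  cone_R C a -> ~ convex_hull (cone_R C) 0 ->
  exists b' l', frame a b' l' u /\ forall p, cone_R C p -> 0 < l' p.
Proof.
move=> CC Co fr Ra hull0; have [_ _ E _ _] := fr.
have hullR p : cone_R C p -> convex_hull (cone_R C) p.
  by move=> Rp; exact: sub_gen_smallest.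
have half01 : 0 < (1 / 2 : R) < 1 by rewrite divr_gt0 //=; lra.
have no2 p q : cone_R C p -> cone_R C q -> p + q <> 0.
  move=> Rp Rq pq; apply: hull0.
  have := convex_hull_combination half01 (hullR _ Rp) (hullR _ Rq).
  rewrite (_ : 1 - 1 / 2 = 1 / 2 :> R); last lra.
  by rewrite -scalerDr pq scaler0.
have no3 p q r : cone_R C p -> cone_R C q -> cone_R C r -> p + q + r <> 0.
  move=> Rp Rq Rr pqr; apply: hull0.
  (* The weights 2/3 and 1/2 nest to the barycentre of three points. *)
  have third01 : 0 < (2 / 3 : R) < 1 by rewrite divr_gt0 //=; lra.
  have := convex_hull_combination third01
    (convex_hull_combination half01 (hullR _ Rp) (hullR _ Rq)) (hullR _ Rr).
  rewrite scalerDr !scalerA (_ : 2 / 3 * (1 / 2) = 1 / 3 :> R); last by field.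
  rewrite (_ : 2 / 3 * (1 - 1 / 2) = 1 / 3 :> R); last by field.
  rewrite (_ : 1 - 2 / 3 = 1 / 3 :> R); last by field.
  by rewrite -!scalerDr pqr scaler0.
pose F := [set t : R | cone_R C (b + (- t) *: a)].
pose G := [set t : R | cone_R C (- b + t *: a)].
have opp t : - (b + (- t) *: a) = - b + t *: a by rewrite opprD scaleNr opprK.
have opp' t : - (- b + t *: a) = b + (- t) *: a by rewrite -opp opprK.
(* A point of [G] too close to [t] would have its opposite in the open set [C], against membership
   in [cone_R C]. *)
have gap t : C (b + (- t) *: a) -> exists2 e : R, 0 < e & forall g, G g -> e <= `|g - t|.
  move=> Ct; have [e e0 He] := open_slice Co Ct; exists e => // g [_]; rewrite opp' => nC.
  by rewrite leNgt; apply/negP => lt; apply/nC/He; rewrite opprK addrC -normrN opprD opprK addrC.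
have gap' t : C (- b + t *: a) -> exists2 e : R, 0 < e & forall f, F f -> e <= `|t - f|.
  move=> Ct; have [e e0 He] := open_slice Co Ct; exists e => // f [_]; rewrite opp => nC.
  by rewrite leNgt; apply/negP => lt; apply/nC/He; rewrite distrC.
have [|e e0 He] := @open_slice R 2 C a b 0 Co; first by rewrite scale0r addr0; case: Ra.
(* For large [t] the opposite of [x - t *: a] is a positive multiple of a small perturbation of [a],
   hence in [C]. *)
have big t x : 0 < t -> e^-1 < t -> x = b \/ x = - b -> ~ cone_R C (x - t *: a).
  move=> t0 te xb [_]; apply; rewrite opprB.
  have -> : t *: a - x = t *: (a - t^-1 *: x).
    by rewrite scalerBr scalerA divff ?gt_eqF // scale1r.
  apply: CC => //; have te' : t^-1 < e by rewrite -[e]invrK ltf_pV2 ?posrE ?invr_gt0.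
  have nt : `|t^-1| = t^-1 by rewrite ger0_norm // invr_ge0 ltW.
  case: xb => ->; last by rewrite scalerN opprK; apply: He; rewrite subr0 nt.
  by rewrite -scaleNr; apply: He; rewrite subr0 normrN nt.
have M0 : 0 < e^-1 by rewrite invr_gt0.
have [|||||c [Fc cG]] := @strict_cut F G e^-1 M0.
- move=> f Ff; rewrite leNgt; apply/negP => ef.
  by apply: (big f b (lt_trans M0 ef) ef (or_introl erefl)); rewrite -scaleNr.
- move=> g Gg; rewrite leNgt; apply/negP => eg.
  have ng : e^-1 < - g by lra.
  apply: (big (- g) (- b) (lt_trans M0 ng) ng (or_intror erefl)).
  by rewrite scaleNr opprK.
(* [g = f] gives two opposite vectors in [cone_R C]; [g < f] gives two whose sum with [(f - g) *: a]
   is 0. *)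
- move=> f g Ff Gg; rewrite ltNge; apply/negP; rewrite le_eqVlt => /orP[/eqP gf|gf].
    by apply: (no2 _ _ Ff Gg); rewrite gf -opp subrr.
  apply: (no3 _ _ ((f - g) *: a) Ff Gg); first by apply/cone_RZ => //; rewrite subr_gt0.
  rewrite [_ + (- b + _)]addrACA subrr add0r -!scalerDl.
  by rewrite (_ : - f + g + (f - g) = 0) ?scale0r //; ring.
- by move=> f [Cf _]; exact: gap.
- by move=> g [Cg _]; exact: gap'.
exists (b - c *: a), (fun x => l x + c * u x); split; first exact: frame_shear.
move=> p Rp; have [un|up|u0] := ltgtP (u p) 0.
- have Gp : G (l p / - u p).
    apply/(cone_RZ _ CC (k := - u p)); first by rewrite oppr_gt0.
    by rewrite scalerDr scalerA mulrC divfK ?oppr_eq0 ?lt_eqF // scalerN scaleNr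
      opprK addrC -E.
  by have := cG _ Gp; rewrite ltr_pdivlMr ?oppr_gt0 //; lra.
- have Fp : F (- l p / u p).
    apply/(cone_RZ _ CC (k := u p)) => //.
    by rewrite scalerDr scalerA -mulNr opprK mulrC divfK ?gt_eqF // addrC -E.
  by have := Fc _ Fp; rewrite ltr_pdivrMr //; lra.
rewrite u0 mulr0 addr0.
have pE : p = l p *: a by rewrite {1}[p]E u0 scale0r addr0.
(* A negative multiple of [a] in [C] would put [- a] in [C]. *)
have [ln|//|l0] := ltgtP (l p) 0.
  case: Ra => _ []; apply/(coneZE _ CC (k := - l p)); first by rewrite oppr_gt0.
  by rewrite scalerN scaleNr opprK -pE; case: Rp.
by case: Rp; rewrite pE l0 scale0r oppr0.
Qed.

End Separation.

(** * Case distinction on the origin, [cone_R C] and [cone_G C] *)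

Theorem theorem1 (R : realType) (C : set 'rV[R]_2) (hC : polytopal_cone C) :
  (exists h : 'rV[R]_2 -> R, hinge_function h /\ C = positivity_set h) <->
  linear_span (cone_G C) `&` convex_hull (cone_R C) = set0.
Proof.
have [Cpoly CC] := hC; have Co := polytopal_set_open Cpoly.
split=> [[h [hh CE]]|disj]; first exact: hinge_separated hh CE.
have [C0|C0] := pselect (C 0).
  exists (fun=> 1); split; last first.
    rewrite (cone_with_origin CC Co C0); apply/esym/seteqP.
    by split=> // x _; exact: ltr01.
  have [m mE] : exists m : {scalar 'rV[R]_2}, m =1 fun=> 0.
    by apply: scalar_ex => k x y; rewrite mulr0 addr0.
  have [||s [t [L [st LA hE]]]] := @hinge_comb R 2 (fun=> 1) [::] => //.
    by exists m, 1 => x; rewrite mE add0r.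
  by exists s, t, L; split=> // x; rewrite -hE big_nil addr0.
have [[r Rr]|R0] := pselect (cone_R C !=set0); last first.
  apply: symmetric_cone_hinge => // p Cp; apply: contrapT => nCp.
  by apply: R0; exists p.
(* A nonzero [w] in [cone_G C] becomes the second axis, on which the form vanishes. *)
have [[w [Gw w0]]|G0] := pselect (exists w, cone_G C w /\ w != 0).
  have [a [u [l fr]]] := frame_ex w0.
  have [|a' [l' [fr' lG lR]]] := separate_line (frameC fr) Gw _ disj.
    by exists r.
  exact: one_sided_cone_hinge fr' lG lR.
have r0 : r != 0 by apply/eqP => r0; case: Rr => Cr _; apply: C0; rewrite -r0.
have [b [l [u fr]]] := frame_ex r0.
(* The span always contains 0, so the hypothesis keeps 0 out of the hull. *)
have [hull0|b' [l' [fr' lR]]] := separate_origin CC Co fr Rr.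
  rewrite -[False]/(set0 (0 : 'rV[R]_2)) -disj; split => //.
  by rewrite -(scale0r r) => W [[/set_mem W0 _] _]; rewrite scale0r.
apply: (one_sided_cone_hinge Cpoly CC C0 fr' _ lR) => // p Gp.
have -> : p = 0.
  by apply/eqP; apply: contrapT => p0; apply: G0; exists p; split=> //; apply/negP.
have [lS _ _ _ _] := fr'; have [m mE] := scalar_ex lS.
by rewrite -mE linear0.
Qed.
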